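(* Let $G$ and $H$ be finite graphs which are F-cores. If $(G,H)$ is an F-gap, then $G$ can be obtained from $H$ by removal of one vertex; that is, there is a vertex $v$ of $H$ such that $G$ is isomorphic to $H\setminus v$, the graph created from $H$ by removing the vertex $v$.
   Context: Graphs are finite, simple and undirected (no loops), written $G=(V_G,E_G)$. A full homomorphism $f:G\to H$ is a mapping $f:V_G\to V_H$ such that for all $u,v\in V_G$, $\{u,v\}\in E_G$ if and only if $\{f(u),f(v)\}\in E_H$ (in particular, two vertices with the same image are non-adjacent). Write $G\leq^F H$ if there exists a full homomorphism $G\to H$; this is a quasi-order on finite graphs. Two graphs are full-homomorphism equivalent if $G\leq^F H$ and $H\leq^F G$. A finite graph is an F-core if it has the minimum number of vertices among all graphs in its equivalence class. A pair $(G,H)$ of F-cores is an F-gap if $G$ and $H$ are non-isomorphic, $G\leq^F H$, and every F-core $H'$ with $G\leq^F H'\leq^F H$ is isomorphic either to $G$ or to $H$. *)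

(* Defs.v *)
From HB Require Import structures.
From mathcomp Require Import all_boot.
Set Implicit Arguments.
Unset Strict Implicit.
Unset Printing Implicit Defensive.

(* The vertex set may be empty. *)
Record sgraph := SGraph {
  vertex :> finType;
  adj : rel vertex;
  adj_sym : symmetric adj;
  adj_irr : irreflexive adj
}.

Definition full_hom (G H : sgraph) (f : G -> H) : Prop :=
  forall u v : G, adj u v <-> adj (f u) (f v).

Definition fhom_le (G H : sgraph) : Prop := exists f : G -> H, full_hom f.

Definition fhom_equiv (G H : sgraph) : Prop := fhom_le G H /\ fhom_le H G.

Definition graph_iso (G H : sgraph) : Prop :=
  exists f : G -> H,
    bijective f /\ forall u v : G, adj u v <-> adj (f u) (f v).

Definition F_core (G : sgraph) : Prop :=
  forall H : sgraph, fhom_equiv G H -> #|G| <= #|H|.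

Definition F_gap (G H : sgraph) : Prop :=
  [/\ F_core G, F_core H, ~ graph_iso G H, fhom_le G H
    & forall H' : sgraph, F_core H' -> fhom_le G H' -> fhom_le H' H ->
        graph_iso H' G \/ graph_iso H' H].

Section DeleteVertex.
Variables (H : sgraph) (v : H).

Definition del_adj : rel {x : H | x != v} := fun x y => adj (val x) (val y).

Lemma del_adj_sym : symmetric del_adj.
Proof. by move=> x y; exact: adj_sym. Qed.

Lemma del_adj_irr : irreflexive del_adj.
Proof. by move=> x; exact: adj_irr. Qed.

Definition del_vertex : sgraph := SGraph del_adj_sym del_adj_irr.
End DeleteVertex.

(* Main.v *)
Require Import Defs.
From mathcomp Require Import all_boot.
From mathcomp Require Import zify.

(** An F-core is a graph without twins (vertices with equal neighbourhoods), so
    a full homomorphism from [G] embeds it in [H].  If [G] misses at least two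
    vertices of [H], the gap condition first forces [#|H| = #|G| + 2].  Let then
    [G] miss exactly [x0] and [x1].  As [H - x1] is not an F-core, [x0] has a
    twin [x2] in it, so the neighbourhoods of [x0] and [x2] differ exactly in
    [x1]; exchanging [x2] for [x0] gives a copy of [G] that misses [x1] and
    [x2].  Iterating yields an infinite sequence with
    [N(x_i) + N(x_(i+2)) = {x_(i+1)}] over F_2.  By symmetry of adjacency,
    [[x_i = x_j]] satisfies a discrete wave equation, so it depends only on
    [j - i] and the sequence is periodic; following the adjacency of consecutive
    terms over an odd period, or the column of [x1] over an even one, gives a
    contradiction. *)

(** * Twinless sets and F-cores *)

Definition twinless (H : sgraph) (A : {set H}) : bool :=
  [forall x in A, forall y in A,
     [forall z in A, adj x z == adj y z] ==> (x == y)].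

Lemma twinlessP (H : sgraph) (A : {set H}) :
  reflect {in A &, forall x y, {in A, adj x =1 adj y} -> x = y} (twinless H A).
Proof.
apply: (iffP forall_inP) => [tA x y xA yA xy | tA x xA].
  have /forall_inP/(_ y yA)/implyP tAx := tA x xA.
  by apply/eqP/tAx/forall_inP => z zA; rewrite xy.
apply/forall_inP => y yA; apply/implyP => /forall_inP xy.
by apply/eqP; apply: tA => // z zA; apply/eqP/xy.
Qed.

Lemma twinlessPn (H : sgraph) (A : {set H}) : ~~ twinless H A ->
  exists x y, [/\ x \in A, y \in A, x != y & {in A, adj x =1 adj y}].
Proof.
case/forall_inPn => x xA /forall_inPn[y yA].
rewrite negb_imply => /andP[/forall_inP xy xNy].
by exists x, y; split=> // z zA; apply/eqP/xy.
Qed.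

Lemma full_homE (G H : sgraph) (f : G -> H) :
  full_hom f <-> forall u v, adj (f u) (f v) = adj u v.
Proof.
split=> hf u v; last by rewrite hf.
by apply/idP/idP => /hf.
Qed.

Lemma full_hom_inj (G H : sgraph) (f : G -> H) :
  twinless G setT -> full_hom f -> injective f.
Proof.
move=> /twinlessP tG /full_homE hf u v fuv.
by apply: tG; rewrite ?inE // => z _; rewrite -!hf fuv.
Qed.

Lemma twinless_imset (G H : sgraph) (f : G -> H) :
  twinless G setT -> full_hom f -> twinless H [set f u | u : G].
Proof.
move=> /twinlessP tG /full_homE hf.
apply/twinlessP => _ _ /imsetP[u _ ->] /imsetP[v _ ->] uv; congr f.
by apply: tG; rewrite ?inE // => z _; rewrite -!hf uv ?imset_f.
Qed.

(** Folding [x] onto a twin [y] would be a full homomorphism into [G] minus [x], an equivalent graph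
    with fewer vertices. *)
Lemma F_core_twinless (G : sgraph) : F_core G -> twinless G setT.
Proof.
move=> cG; apply: contraT => /twinlessPn[x [y [_ _ xNy xy]]].
have yNx : y != x by rewrite eq_sym.
(* The default of [insubd] serves as the value at [x], the only vertex outside the subtype. *)
pose f u : del_vertex x := insubd (exist _ y yNx) u.
have fE u : val (f u) = if u == x then y else u by rewrite val_insubd; case: eqP.
have xyr u : adj u x = adj u y by rewrite !(adj_sym u) xy ?inE.
have eqG : fhom_equiv G (del_vertex x).
  split; last by exists val.
  exists f; apply/full_homE => u v.
  rewrite [LHS]/(del_adj _ _) /del_adj !fE.
  case: (eqVneq u x) => [->|_]; case: (eqVneq v x) => [->|_] //.
  - by rewrite !adj_irr.
  - by rewrite xy ?inE.
have := cG _ eqG; rewrite card_sig.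
have -> : #|[pred x0 | x0 != x]| = #|G|.-1.
  by rewrite -(cardC1 x); apply: eq_card.
have : 0 < #|G| by apply/card_gt0P; exists x.
lia.
Qed.

Definition induced_adj (H : sgraph) (A : {set H}) : rel {x : H | x \in A} :=
  fun x y => adj (val x) (val y).

Lemma induced_adj_sym (H : sgraph) (A : {set H}) : symmetric (induced_adj H A).
Proof. by move=> x y; exact: adj_sym. Qed.

Lemma induced_adj_irr (H : sgraph) (A : {set H}) :
  irreflexive (induced_adj H A).
Proof. by move=> x; exact: adj_irr. Qed.

Definition induced (H : sgraph) (A : {set H}) : sgraph :=
  SGraph (induced_adj_sym H A) (induced_adj_irr H A).

Lemma card_induced (H : sgraph) (A : {set H}) : #|induced H A| = #|A|.
Proof. by rewrite card_sig; apply: eq_card. Qed.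

(** Full homomorphisms out of a twinless graph are injective, so no equivalent graph is smaller. *)
Lemma twinless_F_core (H : sgraph) (A : {set H}) :
  twinless H A -> F_core (induced H A).
Proof.
move=> /twinlessP tA K [[f hf] _].
apply: (@leq_card _ _ f); apply: full_hom_inj hf.
apply/twinlessP => x y _ _ xy; apply/val_inj/tA; rewrite ?(valP x) ?(valP y) //.
by move=> z zA; apply: (xy (exist _ z zA)).
Qed.

(** * Enlarging a copy of [G] inside [H] *)

Lemma graph_iso_card (G H : sgraph) : graph_iso G H -> #|G| = #|H|.
Proof. by case=> f [/bij_eq_card]. Qed.

Lemma F_gap_twinless_card (G H : sgraph) (g : G -> H) (A : {set H}) :
  F_gap G H -> full_hom g -> (forall u, g u \in A) -> twinless H A ->
  #|A| = #|G| \/ #|A| = #|H|.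
Proof.
case=> _ _ _ _ gap hg gA /twinless_F_core cA.
have leG : fhom_le G (induced H A).
  by exists (fun u => exist _ (g u) (gA u)).
have leH : fhom_le (induced H A) H by exists val.
rewrite -card_induced.
by case: (gap _ cA leG leH) => /graph_iso_card; [left | right].
Qed.

(** Twins of the enlarged set cannot both lie in [T], so [v] is one of them. *)
Lemma new_vertex_twin (H : sgraph) (T : {set H}) (v : H) :
  twinless H T -> ~~ twinless H (v |: T) ->
  exists2 s, s \in T :\ v & {in v |: T, adj v =1 adj s}.
Proof.
move=> /twinlessP tT /twinlessPn[x [y []]].
rewrite !in_setU1 => /orP[/eqP->|xT] /orP[/eqP->|yT]; rewrite ?eqxx // => xNy xy.
- by exists y; rewrite // !inE eq_sym xNy.
- by exists x => [|z /xy->]; rewrite // !inE xNy.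
- by case/eqP: xNy; apply: tT => // z zT; rewrite xy // in_setU1 zT orbT.
Qed.

(** A twin of [w] would separate [v] from [s] as [w] does, although they agree on [v |: T]. Twins
    within [v |: T] can only be [v] and [s], and [w] separates these. *)
Lemma separated_twins_twinless (H : sgraph) (T : {set H}) (v s w : H) :
    twinless H T -> s \in T -> {in v |: T, adj v =1 adj s} ->
    adj v w != adj s w -> twinless H (w |: (v |: T)).
Proof.
move=> /twinlessP tT sT vs sep; apply: contraT => /twinlessPn[x [y []]].
have sub z : z \in v |: T -> z \in w |: (v |: T).
  by move=> ?; rewrite in_setU1 orbC; apply/orP; left.
have sVT : s \in v |: T by rewrite in_setU1 sT orbT.
have vVT : v \in v |: T by rewrite setU11.
have wNtwin y' : y' \in v |: T -> {in w |: (v |: T), adj w =1 adj y'} -> False.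
  move=> yVT wy; case/eqP: sep.
  by rewrite !(adj_sym _ w) !wy ?sub // !(adj_sym y') vs.
rewrite !(in_setU1 _ w) => /orP[/eqP->|xVT] /orP[/eqP->|yVT].
- by rewrite eqxx.
- by move=> _ /(wNtwin _ yVT).
- by move=> _ xw; case: (wNtwin _ xVT) => z /xw->.
move=> xNy xy.
have wxy : adj x w = adj y w by rewrite xy ?setU11.
have sE z : z \in T -> {in T, adj v =1 adj z} -> z = s.
  move=> zT vz; apply: tT => // t tT'.
  by rewrite -vz // vs // in_setU1 tT' orbT.
have inT z : z \in T -> z \in w |: (v |: T) by rewrite !inE => ->; rewrite !orbT.
move: xVT yVT; rewrite !in_setU1 => /orP[/eqP xv|xT] /orP[/eqP yv|yT].
- by rewrite xv yv eqxx in xNy.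
- case/eqP: sep; rewrite -(sE y) // -?xv //.
  by move=> z /inT; apply: xy.
- case/eqP: sep; rewrite -(sE x) // -?yv //.
  by move=> z /inT zA; rewrite xy.
- by case/eqP: xNy; apply: tT => // z /inT zA; rewrite xy.
Qed.

(** * Impossibility of an infinite exchange sequence *)

Section FlipSequence.

Variables (H : sgraph) (x : nat -> H).
Hypothesis flip :
  forall i z, adj (x i) z (+) adj (x i.+2) z = (z == x i.+1).

(* Both sides are the sum of the adjacencies between {x_i, x_(i+2)} and
   {x_j, x_(j+2)}. *)
Let wave i j :
  (x j == x i.+1) (+) (x j.+2 == x i.+1) = (x i == x j.+1) (+) (x i.+2 == x j.+1).
Proof.
rewrite -!flip !(adj_sym (x j)) !(adj_sym (x j.+2)).
by do !case: adj.
Qed.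

Let step_neq i : (x i == x i.+1) = false.
Proof.
apply/negP => /eqP xi; have := flip i (x i); have := flip i (x i.+2).
rewrite !adj_irr xi eqxx adj_sym addbF => -> /= /eqP xi2.
by have := flip i (x i.+1); rewrite xi -xi2 !adj_irr eqxx.
Qed.

Let eq_shift k i : (x i == x (i + k)) = (x 0 == x k).
Proof.
elim/ltn_ind: k i => -[|[|k]] IH i; rewrite ?addn0 ?eqxx ?addn1 ?step_neq //.
elim: i => [//|i <-].
(* The two terms at distance [k] cancel by induction, which leaves the two at distance [k.+2], with
   starting points [i] and [i.+1]. *)
have := wave i (i + k).+1; rewrite !addSn !addnS.
have := IH k (leqnSn _) i.+2; have := IH k (leqnSn _) i.+1.
rewrite !addSn (eq_sym (x (i + k).+1)) (eq_sym (x (i + k).+3)) => -> ->.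
by case: eqP; case: eqP; case: eqP.
Qed.

Lemma no_flip_sequence : False.
Proof.
have [k k_gt0 xk] : exists2 k, 0 < k & x 0 == x k.
  have /injectivePn[i [j iNj xij]] : ~~ injectiveb (fun i : 'I_#|H|.+1 => x i).
    by apply/injectiveP => /leq_card; rewrite card_ord ltnn.
  wlog ltij : i j iNj xij / i < j => [hw|].
    case: (ltngtP i j) => [||ij]; [exact: hw | by apply: hw; rewrite 1?eq_sym |].
    by case/eqP: iNj; apply: val_inj.
  exists (j - i); first by rewrite subn_gt0.
  by rewrite -(eq_shift _ i) subnKC ?xij // ltnW.
have [{xk k_gt0}k /andP[k_gt0 xk] k_min] :=
  ex_minnP (ex_intro (fun k => (0 < k) && (x 0 == x k)) k (introT andP (conj k_gt0 xk))).
have /eqP per0 := xk.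
have /eqP per1 : x 1 == x (1 + k) by rewrite eq_shift.
(* By [flip], adjacency of consecutive terms alternates, so after an odd period it would be
   negated. *)
case k_odd: (odd k).
  have alt i : adj (x i) (x i.+1) = adj (x 0) (x 1) (+) odd i.
    elim: i => [|i IH]; first by rewrite addbF.
    have := flip i (x i.+1); rewrite eqxx IH /= (adj_sym (x i.+1)).
    by case: adj; case: adj; case: odd.
  by have := alt k; rewrite -per0 -add1n -per1 k_odd; case: adj.
(* Along even indices, adjacency to [x 1] changes from index 0 to 2, and not again before index [k]:
   another change would need [x 1] to recur at an odd distance from 1, hence a period below the
   minimal [k]. But [x k = x 0]. *)
have col j : j.*2.+2 <= k -> adj (x j.*2.+2) (x 1) = ~~ adj (x 0) (x 1).
  elim: j => [_|j IH le_jk].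
    by have := flip 0 (x 1); rewrite eqxx; do 2!case: adj.
  have := flip j.*2.+2 (x 1); rewrite IH; last by lia.
  rewrite -[j.*2.+3]add1n eq_shift.
  have -> : (x 0 == x j.*2.+2) = false.
    by apply/negP => xj; have := k_min j.*2.+2; rewrite xj => /(_ isT); lia.
  by rewrite add1n; do 2!case: adj.
have kE : k = (k./2.-1).*2.+2 by lia.
have := col k./2.-1; rewrite -kE -per0 leqnn => /(_ isT).
by case: adj.
Qed.

End FlipSequence.

(** * The exchange walk *)

Definition flips (H : sgraph) (a b y : H) : bool :=
  [forall z, adj a z (+) adj y z == (z == b)].

Lemma no_flip_walk (H : sgraph) (P : H -> H -> Prop) (a b : H) :
    (forall a b, P a b -> exists y, flips H a b y) ->
    (forall a b y, P a b -> flips H a b y -> P b y) ->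
  ~ P a b.
Proof.
move=> Pex Pstep Pab.
pose next (p : H * H) := (p.2, odflt p.2 [pick y | flips H p.1 p.2 y]).
pose s i := iter i next (a, b).
have next_flips p : P p.1 p.2 -> flips H p.1 p.2 (next p).2.
  by rewrite /next /= => /Pex[y fy]; case: pickP => //= /(_ y); rewrite fy.
have Ps i : P (s i).1 (s i).2.
  by elim: i => // i IH; apply: Pstep (IH) _; apply: next_flips.
apply: (@no_flip_sequence H (fun i => (s i).1)) => i z.
by have /forallP/(_ z)/eqP := next_flips _ (Ps i).
Qed.

Definition embeds_avoiding (G H : sgraph) (a b : H) : Prop :=
  a != b /\ exists2 g : G -> H, full_hom g & forall u, (g u != a) && (g u != b).

(** Off [b], which the copy avoids, [a] and [y] have the same neighbours, so [a] can replace [y] in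
    the copy. *)
Lemma embeds_avoiding_flips (G H : sgraph) (a b y : H) :
  embeds_avoiding G H a b -> flips H a b y -> embeds_avoiding G H b y.
Proof.
case=> aNb [g /full_homE hg gab] /forallP ay.
have yNa : y != a.
  by apply/eqP => ya; have := ay b; rewrite ya addbb eqxx.
have yNb : y != b.
  apply/eqP => yb; have := ay b; have := ay a.
  by rewrite yb !adj_irr eqxx (negPf aNb) adj_sym addbF => /eqP /= ->.
have twin z : z != b -> adj y z = adj a z.
  by move=> /negPf zb; have := ay z; rewrite zb; do 2!case: adj.
split; first by rewrite eq_sym.
exists (fun u => if g u == y then a else g u); last first.
  move=> u; have /andP[_ gb] := gab u.
  by case: ifPn => [_|guy]; rewrite ?aNb ?gb ?guy // eq_sym yNa.
apply/full_homE => u v; rewrite -hg.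
have [[_ ub] [_ vb]] := (andP (gab u), andP (gab v)).
case: eqP => [->|_]; case: eqP => [->|_] //; rewrite ?adj_irr ?twin //.
by rewrite !(adj_sym (g u)) twin.
Qed.

(** Adding [a] to the copy gives a size strictly between those of [G] and [H], so [a] acquires a
    twin [y]. As [H] is twinless, the one remaining vertex [b] must separate them. *)
Lemma F_gap_flips (G H : sgraph) (a b : H) :
    F_gap G H -> #|H| = #|G|.+2 -> embeds_avoiding G H a b ->
  exists y, flips H a b y.
Proof.
move=> gap cardH [aNb [g hg gab]].
have [cG cH _ _ _] := gap.
have ginj := full_hom_inj _ _ _ (F_core_twinless _ cG) hg.
have cT : #|[set g u | u : G]| = #|G| by rewrite card_imset.
have tT := twinless_imset _ _ _ (F_core_twinless _ cG) hg.
have aT : a \notin [set g u | u : G].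
  by apply/imsetP => -[u _ au]; have := gab u; rewrite -au eqxx.
have bT : b \notin a |: [set g u | u : G].
  rewrite in_setU1 negb_or eq_sym aNb /=.
  by apply/imsetP => -[u _ bu]; have := gab u; rewrite -bu eqxx andbF.
have full : b |: (a |: [set g u | u : G]) = setT.
  by apply/eqP; rewrite eqEcard subsetT cardsT !cardsU1 bT aT cT cardH !add1n leqnn.
have NtA : ~~ twinless H (a |: [set g u | u : G]).
  apply/negP => /(F_gap_twinless_card _ _ _ _ gap hg) gA.
  by case: gA => [u||]; rewrite ?in_setU1 ?imset_f ?orbT // cardsU1 aT cT; lia.
have [y yT ay] := new_vertex_twin _ _ _ tT NtA.
have ayb : adj a b != adj y b.
  apply/eqP => ayb; move: yT; rewrite !inE => /andP[/eqP[]].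
  rewrite (twinlessP _ _ (F_core_twinless _ cH) y a) ?inE // => z _.
  have : z \in b |: (a |: [set g u | u : G]) by rewrite full inE.
  by rewrite in_setU1 => /orP[/eqP->|/ay].
exists y; apply/forallP => z.
have : z \in b |: (a |: [set g u | u : G]) by rewrite full inE.
rewrite in_setU1 => /orP[/eqP->|zA].
  by rewrite eqxx; move: ayb; do 2!case: adj.
rewrite ay // addbb; case: (eqVneq z b) => // zb.
by rewrite zb (negPf bT) in zA.
Qed.

Theorem theorem1p1 (G H : sgraph) (hG : F_core G) (hH : F_core H)
  (hgap : F_gap G H) :
  exists v : H, graph_iso G (del_vertex v).
Proof.
have [_ _ GNH [g hg] _] := hgap.
have tG := F_core_twinless _ hG; have tH := F_core_twinless _ hH.
have ginj := full_hom_inj _ _ _ tG hg.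
pose T := [set g u | u : G].
have gT u : g u \in T by apply: imset_f.
have cT : #|T| = #|G| by rewrite card_imset.
have tT : twinless H T := twinless_imset _ _ _ tG hg.
have leGH : #|G| <= #|H| by apply: leq_card ginj.
have [eqGH|ltGH] : #|H| <= #|G| \/ #|G| < #|H| by lia.
  by case: GNH; exists g; split; [apply: inj_card_bij | ].
have [v vT] : exists v, v \notin T.
  apply/existsP; rewrite -negb_forall; apply: contraL ltGH => /forallP allT.
  rewrite -leqNgt -cT -cardsT; apply: subset_leq_card.
  by apply/subsetP => x _; apply: allT.
have gNv u : g u != v by apply: contraNneq vT => <-.
have [eq1|lt1] : #|H| = #|G|.+1 \/ #|G|.+1 < #|H| by lia.
  exists v, (fun u => exist _ (g u) (gNv u)); split; last exact: hg.
  apply: inj_card_bij => [x y [/ginj]//|].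
  rewrite card_sig [X in X <= _](_ : _ = #|G|) //.
  by apply: succn_inj; rewrite -eq1 (cardD1 v H) inE add1n; congr _.+1;
     apply: eq_card => x; rewrite !inE andbT.
(* The size [#|G|.+1] is neither that of [G] nor that of [H]. *)
have NtA : ~~ twinless H (v |: T).
  apply/negP => /(F_gap_twinless_card _ _ _ _ hgap hg) gA.
  by case: gA => [u||]; rewrite ?in_setU1 ?gT ?orbT // cardsU1 vT cT; lia.
have [s] := new_vertex_twin _ _ _ tT NtA; rewrite !inE => /andP[sNv sT] vs.
have [w sep] : exists w, adj v w != adj s w.
  apply/existsP; rewrite -negb_forall; apply: contra sNv => /forallP vs'.
  apply/eqP/esym; apply: (twinlessP _ _ tH); rewrite ?inE // => z _.
  exact/eqP.
have wA : w \notin v |: T by apply: contra sep => /vs ->.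
(* The twinless set [w |: (v |: T)] has two more vertices than [G], so its size must be that of
   [H]. *)
have cardH : #|H| = #|G|.+2.
  have := separated_twins_twinless _ _ _ _ _ tT sT vs sep.
  move=> /(F_gap_twinless_card _ _ _ _ hgap hg) gA.
  by case: gA => [u||]; rewrite ?in_setU1 ?gT ?orbT // !cardsU1 wA vT cT; lia.
case: (@no_flip_walk H (embeds_avoiding G H) v w).
- by move=> a b; apply: F_gap_flips.
- by move=> a b y; apply: embeds_avoiding_flips.
move: wA; rewrite in_setU1 negb_or => /andP[wNv wT].
split; first by rewrite eq_sym.
exists g => // u; rewrite gNv; apply: contraNneq wT => <-; exact: gT.
Qed.
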